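(* Given an $N \times N$ Hermitian matrix $P$ and a general $N \times K$ matrix $H$ of rank $L$, both over $\mathbb{C}$, the $L$ eigenvalues of the $K \times K$ matrix $T$ resulting from the pseudo-similarity transformation $T = H^{\dagger} P H$ will interlace those of $P$. That is, writing $\lambda_1 \leq \lambda_2 \leq \dots \leq \lambda_N$ for the eigenvalues of $P$ in non-decreasing order and $\eta_1 \leq \eta_2 \leq \dots \leq \eta_L$ for the $L$ eigenvalues of $T$ in non-decreasing order, $$\lambda_l \leq \eta_l \leq \lambda_{N-L+l}, \qquad l = 1, 2, \dots, L.$$
   Context: For a complex $N \times K$ matrix $H$, $H^{\dagger}$ denotes its pseudo-inverse (a $K \times N$ matrix). Given an $N \times N$ matrix $P$, the product $H^{\dagger} P H$ is called a pseudo-similarity transformation of $P$. No relation between $K$ and $N$ is assumed; in particular $K \geq N$ is allowed. Where the $K \times K$ matrix $T$ has more than $L$ eigenvalues ($K > L$), the paper refers to the $L$ eigenvalues in question as the $L$ nonzero eigenvalues of $T$, the other $K-L$ eigenvalues being zeros. *)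

(* Defs.v *)
From mathcomp Require Import all_boot all_order all_algebra.

Set Implicit Arguments.
Unset Strict Implicit.
Unset Printing Implicit Defensive.

Import Order.TTheory GRing.Theory Num.Theory.
Local Open Scope ring_scope.
Local Open Scope sesquilinear_scope.

(* The four Penrose equations: [G] is the (Moore-Penrose) pseudo-inverse of
   [H]. The library's [pinvmx] is only a one-sided partial inverse. *)
Definition is_pseudo_inverse (C : numClosedFieldType) (m n : nat)
    (H : 'M[C]_(m, n)) (G : 'M[C]_(n, m)) : Prop :=
  [/\ H *m G *m H = H,
      G *m H *m G = G,
      (H *m G) ^t* = H *m G &
      (G *m H) ^t* = G *m H].

(* The eigenvalues of [A], with algebraic multiplicity, are the entries of
   [s]; this determines [s] up to permutation, see [eigenvalues_perm]. *)
Definition has_eigenvalues (C : numClosedFieldType) (n : nat)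
    (A : 'M[C]_n) (s : seq C) : Prop :=
  char_poly A = \prod_(z <- s) ('X - z%:P).

Lemma eigenvalues_perm (C : numClosedFieldType) (n : nat) (A : 'M[C]_n)
    (s t : seq C) :
  has_eigenvalues A s -> has_eigenvalues A t -> perm_eq s t.
Proof. by rewrite /has_eigenvalues => ->; exact: prod_XsubC_eq. Qed.

Section PseudoInverse.
Variable C : numClosedFieldType.

Lemma trmxC_mul m n p (A : 'M[C]_(m, n)) (B : 'M[C]_(n, p)) :
  (A *m B) ^t* = B ^t* *m A ^t*.
Proof. by rewrite trmx_mul map_mxM. Qed.

Lemma mulmx_trmxC_eq0 m n (A : 'M[C]_(m, n)) : A *m A ^t* = 0 -> A = 0.
Proof.
move=> A0; apply/matrixP => i j; rewrite mxE.
have := congr1 (fun M : 'M_m => M i i) A0; rewrite !mxE => /eqP.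
rewrite psumr_eq0 => [/allP/(_ j (mem_index_enum _))|k _]; rewrite !mxE.
  by rewrite -normCK /= sqrf_eq0 normr_eq0 => /eqP.
by rewrite -normCK exprn_ge0.
Qed.

Lemma gram_unitmx m n (A : 'M[C]_(m, n)) : row_free A -> A *m A ^t* \in unitmx.
Proof.
move=> fA; rewrite -row_free_unit -kermx_eq0; apply/eqP.
set Z := kermx _; have /eqP := mulmx_ker (A *m A ^t*).
rewrite -/Z => /eqP ZA; apply/eqP; rewrite -(mulmx_free_eq0 _ fA); apply/eqP.
apply: mulmx_trmxC_eq0.
by rewrite trmxC_mul -mulmxA [A *m _]mulmxA mulmxA ZA mul0mx.
Qed.

Lemma pseudo_inverse_exists m n (H : 'M[C]_(m, n)) :
  exists G, is_pseudo_inverse H G.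
Proof.
have [r [A [B [HE uA uB]]]] : exists r (A : 'M[C]_(m, r)) (B : 'M[C]_(r, n)),
    [/\ H = A *m B, A ^t* *m A \in unitmx & B *m B ^t* \in unitmx].
  exists (\rank H), (col_base H), (row_base H); split.
  - by rewrite mulmx_base.
  - have := @gram_unitmx _ _ ((col_base H) ^t* ); rewrite trmxCK; apply.
    rewrite /row_free mxrank_map mxrank_tr.
    by have := col_base_full H; rewrite /row_full.
  - by apply: gram_unitmx; exact: row_base_free.
pose G := B ^t* *m invmx (B *m B ^t* ) *m (invmx (A ^t* *m A) *m A ^t* ).
have KA p (X : 'M_(_, p)) : invmx (A ^t* *m A) *m (A ^t* *m (A *m X)) = X.
  by rewrite (mulmxA _ A) mulKmx.
have KB p (X : 'M_(_, p)) : B *m (B ^t* *m (invmx (B *m B ^t* ) *m X)) = X.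
  by rewrite mulmxA mulKVmx.
have HG : H *m G = A *m (invmx (A ^t* *m A) *m A ^t* ).
  by rewrite HE /G -!mulmxA KB.
have GH : G *m H = B ^t* *m (invmx (B *m B ^t* ) *m B).
  by rewrite HE /G -!mulmxA KA.
have herm_inv p (M : 'M[C]_p) : M ^t* = M -> (invmx M) ^t* = invmx M.
  by move=> hM; rewrite trmx_inv map_invmx hM.
exists G; split.
- by rewrite HG HE -!mulmxA KA.
- by rewrite GH /G -!mulmxA KB.
- by rewrite HG !trmxC_mul herm_inv ?trmxC_mul ?trmxCK ?mulmxA.
- by rewrite GH !trmxC_mul herm_inv ?trmxC_mul ?trmxCK ?mulmxA.
Qed.

Lemma pseudo_inverse_unique m n (H : 'M[C]_(m, n)) G1 G2 :
  is_pseudo_inverse H G1 -> is_pseudo_inverse H G2 -> G1 = G2.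
Proof.
move=> [a1 b1 c1 d1] [a2 b2 c2 d2].
have HG : H *m G1 = H *m G2.
  by rewrite -c1 -{1}a2 -mulmxA trmxC_mul c1 c2 mulmxA a1.
have GH : G1 *m H = G2 *m H.
  by rewrite -d1 -{1}a2 !mulmxA -[_ *m G2 *m H]mulmxA trmxC_mul d1 d2
             -mulmxA [H *m _]mulmxA a1.
by rewrite -b1 GH -mulmxA HG mulmxA b2.
Qed.

End PseudoInverse.

(* Main.v *)
Require Import Defs.
From mathcomp Require Import all_boot all_order all_algebra.
From mathcomp Require Import fingroup perm complex reals.

Set Implicit Arguments.
Unset Strict Implicit.
Unset Printing Implicit Defensive.

Import Order.TTheory GRing.Theory Num.Theory.
Local Open Scope ring_scope.
Local Open Scope complex_scope.

(* The Hermitian idempotent H H^dagger is Q^* Q for some Q with L orthonormal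
   rows, so up to zeros T has the spectrum of the compression Q P Q^*.  In
   eigenbases this compression reads V diag(lam) V^* = diag(eta) with V V^* = 1,
   and the two bounds come from a dimension count as in Courant-Fischer: a
   coordinate subspace for eta and one for lam of total dimension above N
   contain a common nonzero vector, and the two expressions of the quadratic
   form at that vector compare eta_l with the corresponding lam. *)

Local Open Scope sesquilinear_scope.

(** Sylvester's identity: eliminating either diagonal block of [M] leaves 'X - AB or 'X - BA as
    Schur complement. The powers of 'X on both sides avoid dividing by 'X and any comparison of [m]
    with [n]. *)
Lemma char_poly_mulmxC (R : comNzRingType) m n
    (A : 'M[R]_(m, n)) (B : 'M[R]_(n, m)) :
  'X^n * char_poly (A *m B) = 'X^m * char_poly (B *m A).
Proof.
rewrite /char_poly /char_poly_mx !map_mxM.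
move: (map_mx _ A) (map_mx _ B) => a b.
pose M := block_mx 'X%:M a b 1%:M.
have -> : \det ('X%:M - a *m b) = \det M.
  have eM : M *m block_mx 1%:M 0 (- b) 1%:M
            = block_mx ('X%:M - a *m b) a 0 1%:M.
    rewrite mulmx_block !mulmx1 !mulmx0 mul1mx mulmxN add0r.
    by rewrite addrN add0r.
  have := congr1 determinant eM.
  by rewrite det_mulmx det_lblock det_ublock !det1 !mulr1 => ->.
have eM : block_mx 1%:M 0 (- b) 'X%:M *m M
          = block_mx 'X%:M a 0 ('X%:M - b *m a).
  rewrite mulmx_block !mul1mx !mul0mx !addr0 mulmx1 !mulNmx.
  by rewrite mul_mx_scalar mul_scalar_mx addNr addrC.
have := congr1 determinant eM.
by rewrite det_mulmx det_lblock det_ublock !det_scalar expr1n mul1r.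
Qed.

Lemma char_poly_mulmxC_sq (F : fieldType) n (A B : 'M[F]_n) :
  char_poly (A *m B) = char_poly (B *m A).
Proof.
apply: (mulfI (x := 'X^n)); first by rewrite -size_poly_eq0 size_polyXn.
exact: char_poly_mulmxC.
Qed.

Lemma hermsymmxP (C : numClosedFieldType) n (A : 'M[C]_n) :
  reflect (A ^t* = A) (A \is hermsymmx).
Proof.
by rewrite is_hermitianmxE expr0 scale1r; apply: (iffP eqP) => /esym.
Qed.

Lemma orthonormal_row_basis (C : numClosedFieldType) m n (A : 'M[C]_(m, n)) :
  exists2 Q : 'M[C]_(\rank A, n), Q \is unitarymx & (Q :=: A)%MS.
Proof.
exists (schmidt (row_base A)); first exact/schmidt_unitarymx/rank_leq_col.
apply: eqmx_trans (eq_row_base A).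
exact/eqmx_schmidt_free/row_base_free.
Qed.

(** The rows of [Q] are an orthonormal basis of the row space of [E]. Idempotence gives QE = Q, the
    adjoint of which is EQ^* = Q^*. Writing E = YQ then yields Q^* Q = EQ^* Q = YQQ^* Q = YQ = E. *)
Lemma hermitian_idempotent_factor (C : numClosedFieldType) n r (E : 'M[C]_n) :
    E ^t* = E -> E *m E = E -> \rank E = r ->
  exists2 Q : 'M[C]_(r, n), Q \is unitarymx & Q ^t* *m Q = E.
Proof.
move=> hE idE rE.
have [Q uQ eqQ] : exists2 Q : 'M[C]_(r, n), Q \is unitarymx & (Q :=: E)%MS.
  by case: r / rE; exact: orthonormal_row_basis.
exists Q => //.
have /submxP[Y EY] : (E <= Q)%MS by rewrite eqQ.
have /submxP[Z QZ] : (Q <= E)%MS by rewrite eqQ.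
have QE : Q *m E = Q by rewrite QZ -mulmxA idE.
have EQ : E *m Q ^t* = Q ^t* by rewrite -{1}hE -trmxC_mul QE.
by rewrite -EQ EY -(mulmxA Y) (unitarymxP uQ) mulmx1.
Qed.

Lemma quadratic_diag (C : numClosedFieldType) n (u : 'rV[C]_n) (d : 'rV[C]_n) :
  (u *m diag_mx d *m u ^t* ) 0 0 = \sum_i d 0 i * `|u 0 i| ^+ 2.
Proof.
rewrite mxE; apply: eq_bigr => i _.
by rewrite mul_mx_diag !mxE normCK mulrA [d 0 i * _]mulrC.
Qed.

Lemma quadratic_norm (C : numClosedFieldType) n (u : 'rV[C]_n) :
  (u *m u ^t* ) 0 0 = \sum_i `|u 0 i| ^+ 2.
Proof. by rewrite mxE; apply: eq_bigr => i _; rewrite !mxE normCK. Qed.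

Lemma coordinate_subspaces_meet (F : fieldType) m n (V : 'M[F]_(m, n))
    (I : {set 'I_n}) (J : {set 'I_m}) :
    (n < #|I| + #|J|)%N ->
  exists u : 'rV[F]_m, [/\ u != 0, forall j, j \notin J -> u 0 j = 0 &
    forall i, i \notin I -> (u *m V) 0 i = 0].
Proof.
move=> ltn.
(* The entries of [u *m S] are those of [u] outside [J], then those of [u *m V] outside [I]. Since
   [S] has fewer than [m] columns, its left kernel is nonzero. *)
pose S := row_mx (colsub (@enum_val _ (mem (~: J))) 1%:M)
                 (colsub (@enum_val _ (mem (~: I))) V).
have ker_nz : kermx S != 0.
  rewrite -mxrank_eq0 mxrank_ker subn_eq0 -ltnNge.
  apply: leq_ltn_trans (rank_leq_col _) _.
  have lt_IJ : (#|~: I| < #|J|)%N.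
    by rewrite -(ltn_add2l #|I|) cardsC card_ord.
  have cJ : (#|J| + #|~: J|)%N = m by rewrite cardsC card_ord.
  by rewrite -[ltnRHS]cJ addnC ltn_add2r.
have /rowV0Pn[u /sub_kermxP uS u_nz] := ker_nz.
move: uS; rewrite mul_mx_row => /eqP; rewrite row_mx_eq0 => /andP[/eqP uJ /eqP uI].
exists u; split=> // [j|i].
  rewrite -in_setC => jJ.
  have /rowP/(_ (enum_rank_in jJ j)) := uJ.
  by rewrite mulmx_colsub mulmx1 !mxE enum_rankK_in.
rewrite -in_setC => iI.
have /rowP/(_ (enum_rank_in iI i)) := uI.
by rewrite mulmx_colsub !mxE enum_rankK_in.
Qed.

(** At a common vector [u], with w = uV of the same norm, a |u|^2 <= sum d_i |w_i|^2 = sum e_j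
    |u_j|^2 <= b |u|^2, because only indices in [I] and [J] contribute. Then |u|^2 > 0 cancels. *)
Lemma compression_diag_le (C : numClosedFieldType) m n (V : 'M[C]_(m, n))
    (d : 'rV[C]_n) (e : 'rV[C]_m) (I : {set 'I_n}) (J : {set 'I_m}) (a b : C) :
    V \is unitarymx -> V *m diag_mx d *m V ^t* = diag_mx e ->
    (n < #|I| + #|J|)%N ->
    {in I, forall i, a <= d 0 i} -> {in J, forall j, e 0 j <= b} ->
  a <= b.
Proof.
move=> uV Vd ltn aI bJ.
have [u [u_nz uJ uI]] := coordinate_subspaces_meet V ltn.
have eq_form : \sum_i d 0 i * `|(u *m V) 0 i| ^+ 2
               = \sum_j e 0 j * `|u 0 j| ^+ 2.
  by rewrite -!quadratic_diag trmxC_mul -Vd !mulmxA.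
have eq_norm : \sum_i `|(u *m V) 0 i| ^+ 2 = \sum_j `|u 0 j| ^+ 2.
  by rewrite -!quadratic_norm trmxC_mul -mulmxA (mulmxA V) (unitarymxP uV) mul1mx.
have s_gt0 : 0 < \sum_j `|u 0 j| ^+ 2.
  rewrite lt_def sumr_ge0 ?andbT => [|j _]; last by rewrite exprn_ge0.
  apply: contra u_nz => /eqP s0; apply/eqP/mulmx_trmxC_eq0.
  by apply/matrixP => i j; rewrite !ord1 quadratic_norm s0 mxE.
rewrite -(ler_pM2r s_gt0) -[in a * _]eq_norm !mulr_sumr.
apply: (@le_trans _ _ (\sum_i d 0 i * `|(u *m V) 0 i| ^+ 2)).
  apply: ler_sum => i _; have [iI|/uI->] := boolP (i \in I).
    by rewrite ler_wpM2r ?exprn_ge0 ?aI.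
  by rewrite normr0 expr0n !mulr0.
rewrite eq_form; apply: ler_sum => j _; have [jJ|/uJ->] := boolP (j \in J).
  by rewrite ler_wpM2r ?exprn_ge0 ?bJ.
by rewrite normr0 expr0n !mulr0.
Qed.

Lemma compression_diag_ge (C : numClosedFieldType) m n (V : 'M[C]_(m, n))
    (d : 'rV[C]_n) (e : 'rV[C]_m) (I : {set 'I_n}) (J : {set 'I_m}) (a b : C) :
    V \is unitarymx -> V *m diag_mx d *m V ^t* = diag_mx e ->
    (n < #|I| + #|J|)%N ->
    {in I, forall i, d 0 i <= a} -> {in J, forall j, b <= e 0 j} ->
  b <= a.
Proof.
move=> uV Vd ltn aI bJ; rewrite -lerN2.
apply: (@compression_diag_le _ _ _ V (- d) (- e) I J) => // [|i iI|j jJ].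
- by rewrite !raddfN /= mulNmx Vd.
- by rewrite mxE lerN2 aI.
- by rewrite mxE lerN2 bJ.
Qed.

(** The diagonal is stored as a tuple of reals because it has to be sorted and the order on [R[i]]
    is only partial. *)
Definition real_diag (R : rcfType) n (t : n.-tuple R) : 'M[R[i]]_n :=
  diag_mx (\row_i (tnth t i)%:C).

Lemma char_poly_real_diag (R : rcfType) n (t : n.-tuple R) :
  has_eigenvalues (real_diag t) [seq x%:C | x <- t].
Proof.
rewrite /has_eigenvalues char_poly_trig ?diag_mx_is_trig// big_map big_tuple.
by apply: eq_bigr => i _; rewrite !mxE eqxx.
Qed.

(** The spectral theorem gives a real diagonal in arbitrary order; the permutation [p] that sorts it
    is absorbed into the unitary factor by permuting its rows. *)
Lemma hermitian_sorted_spectral (R : rcfType) n (A : 'M[R[i]]_n) :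
    A \is hermsymmx ->
  exists (U : 'M[R[i]]_n) (t : n.-tuple R),
    [/\ U \is unitarymx, sorted <=%R t & A = U ^t* *m real_diag t *m U].
Proof.
move=> hA; pose U := spectralmx A; pose d := spectral_diag A.
have uU : U \is unitarymx by exact: spectral_unitarymx.
have AE : A = U ^t* *m diag_mx d *m U.
  rewrite -invmx_unitary//; exact/orthomx_spectralP/hermitian_normalmx.
have dE i : d 0 i = (complex.Re (d 0 i))%:C.
  have /mxOverP/(_ 0 i) := hermitian_spectral_diag_real hA.
  by rewrite -/d; case: (d 0 i) => x y /complex_realP[z ->].
pose t0 := [tuple complex.Re (d 0 i) | i < n].
have /tuple_permP[p tE] : perm_eq (sort <=%R t0) t0 by rewrite perm_sort.
pose t := [tuple tnth t0 (p i) | i < n].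
exists (row_perm p U), t; split.
- apply/unitarymxP; rewrite row_permE trmxC_mul -mulmxA (mulmxA U).
  rewrite (unitarymxP uU) mul1mx tr_perm_mx map_perm_mx -perm_mxM.
  by rewrite mulgV perm_mx1.
- by rewrite -tE sort_le_sorted.
- rewrite row_permE trmxC_mul tr_perm_mx map_perm_mx AE !mulmxA.
  congr (_ *m _); rewrite -!mulmxA; congr (_ *m _).
  have -> : real_diag t = perm_mx p *m diag_mx d *m perm_mx p^-1.
    rewrite -row_permE -[p]invgK -col_permE invgK; apply/matrixP => i j.
    by rewrite !mxE !tnth_mktuple (inj_eq perm_inj) -dE.
  by rewrite !mulmxA -perm_mxM mulVg perm_mx1 mul1mx -mulmxA -perm_mxM mulVg
             perm_mx1 mulmx1.
Qed.

Lemma spectral_has_eigenvalues (R : rcfType) n (A U : 'M[R[i]]_n)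
    (t : n.-tuple R) :
  U \is unitarymx -> A = U ^t* *m real_diag t *m U ->
  has_eigenvalues A [seq x%:C | x <- t].
Proof.
move=> uU ->; rewrite /has_eigenvalues -mulmxA char_poly_mulmxC_sq -mulmxA.
by rewrite (unitarymxP uU) mulmx1; exact: char_poly_real_diag.
Qed.

Lemma card_ord_geq n k : #|[set i : 'I_n | (k <= i)%N]| = (n - k)%N.
Proof.
rewrite -sum1dep_card -(big_mkord (fun i => k <= i)%N (fun=> 1%N)).
by rewrite -(big_nat_widenl _ _ _ xpredT)// sum_nat_const_nat muln1.
Qed.

Lemma card_ord_ltn n k : (k <= n)%N -> #|[set i : 'I_n | (i < k)%N]| = k.
Proof.
move=> le_kn; rewrite -sum1dep_card -(big_mkord (fun i => i < k)%N (fun=> 1%N)).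
by rewrite -(big_nat_widen _ _ _ xpredT)// sum_nat_const_nat muln1 subn0.
Qed.

Theorem mainTheorem1 (R : realType) (N K L : nat)
    (P : 'M[R[i]]_N) (H : 'M[R[i]]_(N, K)) (Hd : 'M[R[i]]_(K, N)) :
  P \is hermsymmx ->
  \rank H = L ->
  is_pseudo_inverse H Hd ->
  let T := Hd *m P *m H in
  exists lam eta : seq R,
    [/\ [/\ size lam = N, sorted <=%R lam &
            has_eigenvalues P [seq x%:C | x <- lam]],
        [/\ size eta = L, sorted <=%R eta &
            has_eigenvalues T ([seq x%:C | x <- eta] ++ nseq (K - L) 0)] &
        forall l : nat, (l < L)%N ->
          lam`_l <= eta`_l /\ eta`_l <= lam`_(N - L + l)].
Proof.
move=> hP rH [HGH GHG hHG _] T.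
(* Each of H and HH^dagger is a multiple of the other, since H = (HH^dagger)H. *)
have rE : \rank (H *m Hd) = L.
  apply/eqP; rewrite -rH eqn_leq mxrankM_maxl /=.
  by rewrite -{1}HGH mxrankM_maxl.
have idE : H *m Hd *m (H *m Hd) = H *m Hd by rewrite mulmxA HGH.
have [Q uQ QE] := hermitian_idempotent_factor hHG idE rE.
pose M := Q *m P *m Q ^t*.
have hM : M \is hermsymmx.
  by apply/hermsymmxP; rewrite !trmxC_mul trmxCK (hermsymmxP _ hP) mulmxA.
have [U [lam [uU lam_sorted PE]]] := hermitian_sorted_spectral hP.
have [W [eta [uW eta_sorted ME]]] := hermitian_sorted_spectral hM.
(* These bounds make the truncated differences [K - L] and [N - L] genuine. *)
have leLK : (L <= K)%N by rewrite -rH rank_leq_col.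
have leLN : (L <= N)%N by rewrite -rH rank_leq_row.
have charT : char_poly T = 'X^(K - L) * char_poly M.
  have X_nz k : 'X^k != 0 :> {poly R[i]} by rewrite -size_poly_eq0 size_polyXn.
  apply: (mulfI (X_nz L)); rewrite mulrA -exprD subnKC//.
  apply: (mulfI (X_nz N)).
  rewrite mulrCA /T -mulmxA char_poly_mulmxC -mulmxA -QE mulmxA.
  by rewrite mulrCA char_poly_mulmxC mulrCA mulmxA.
(* [V] expresses the eigenbasis of the compression [M] in the eigenbasis of [P]. *)
pose V := W *m Q *m U ^t*.
have uV : V \is unitarymx by rewrite !mul_unitarymx ?trmxC_unitary.
have VE : V *m real_diag lam *m V ^t* = real_diag eta.
  have -> : real_diag eta = W *m M *m W ^t*.
    by rewrite ME !mulmxA (unitarymxP uW) mul1mx mulmxtVK.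
  by rewrite /M PE !trmxC_mul trmxCK !mulmxA.
have mono k (t : k.-tuple R) (i j : nat) :
  sorted <=%R t -> (i <= j < k)%N -> t`_i <= t`_j.
  move=> t_sorted /andP[le_ij lt_jk].
  have lt_ik := leq_ltn_trans le_ij lt_jk.
  by apply: (sorted_leq_nth le_trans) => //; rewrite inE size_tuple.
have entryE k (t : k.-tuple R) (i : 'I_k) :
  (\row_j (tnth t j)%:C : 'rV[R[i]]_k) 0 i = (t`_i)%:C.
  by rewrite mxE (tnth_nth 0).
exists lam, eta; split.
- by split; [rewrite size_tuple | | exact: spectral_has_eigenvalues PE].
- split; [by rewrite size_tuple | by [] | ].
  rewrite /has_eigenvalues charT big_cat /= -(spectral_has_eigenvalues uW ME).
  by rewrite mulrC big_nseq subr0 iter_mulr_1.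
- move=> l lt_lL; split; rewrite -(@lecR R).
  (* Indices start at 0, so the two sets have N - l and l + 1 elements, together N + 1. *)
  + apply: (compression_diag_le (I := [set i : 'I_N | (l <= i)%N])
              (J := [set j : 'I_L | (j < l.+1)%N]) uV VE) => [|i|j].
    * by rewrite card_ord_geq card_ord_ltn// addnS subnK// ltnW// (leq_trans lt_lL).
    * by rewrite inE => le_li; rewrite entryE lecR mono ?le_li/=.
    * by rewrite inE ltnS => le_jl; rewrite entryE lecR mono ?le_jl.
  (* Here the sizes are N - L + l + 1 and L - l, again N + 1 in total. *)
  + apply: (compression_diag_ge (I := [set i : 'I_N | (i < (N - L + l).+1)%N])
              (J := [set j : 'I_L | (l <= j)%N]) uV VE) => [|i|j].
    * rewrite card_ord_geq card_ord_ltn; last first.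
        by rewrite -[leqRHS](subnK leLN) -addnS leq_add2l.
      by rewrite addSn -addnA subnKC ?subnK// ltnW.
    * rewrite inE ltnS => le_il; rewrite entryE lecR mono ?le_il//=.
      by rewrite -[ltnRHS](subnK leLN) ltn_add2l.
    * by rewrite inE => le_lj; rewrite entryE lecR mono ?le_lj/=.
Qed.
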